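(* Let $\varphi$ be a renormalization of a finitely generated group $\Gamma$. The Cantor action $\Phi_{\varphi} \colon \Gamma \times X_{\varphi} \to X_{\varphi}$ associated to $\varphi$ is quasi-analytic. Hence, if the action $\Phi_{\varphi}$ is effective, then it is topologically free.
   Context: A renormalization of a countable group $\Gamma$ is an injective homomorphism $\varphi\colon\Gamma\to\Gamma$ whose image is a proper subgroup of finite index. Put $\Gamma_0=\Gamma$, $\Gamma_\ell=\varphi^\ell(\Gamma)$, $X_\ell=\Gamma/\Gamma_\ell$ (left cosets), and let $X_\varphi=\varprojlim X_\ell$ be the inverse limit under the natural quotient maps $X_{\ell+1}\to X_\ell$; it is a Cantor space. The left translation actions of $\Gamma$ on the $X_\ell$ induce a minimal equicontinuous action $\Phi_\varphi$ of $\Gamma$ on $X_\varphi$. An action $\Phi\colon H\times\mathfrak{X}\to\mathfrak{X}$ of a topological group $H$ on a Cantor space $\mathfrak{X}$ is quasi-analytic if for each non-empty clopen set $U\subset\mathfrak{X}$ and each $g\in H$ with $\Phi(g)(U)=U$ and $\Phi(g)|U$ the identity map of $U$, the map $\Phi(g)$ is the identity on all of $\mathfrak{X}$. An action is effective if the homomorphism $\Gamma\to\mathrm{Homeo}(\mathfrak{X})$ has trivial kernel. An action of $\Gamma$ on $\mathfrak{X}$ is topologically free if the set $\{x\in\mathfrak{X}\mid \exists\,\gamma\in\Gamma,\ \gamma\neq e,\ \gamma x=x\}$ is meager in $\mathfrak{X}$. *)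

(* Defs.v *)
From mathcomp Require Import all_boot.
From mathcomp Require Import all_classical topology.

Set Implicit Arguments.
Unset Strict Implicit.
Unset Printing Implicit Defensive.

Import Algebra.
Local Open Scope classical_set_scope.
Local Open Scope group_scope.

Section Cosets.
Context {G : groupType}.
Implicit Types (A B C : set G) (g x : G).

Definition subgroup A := group_closed (fun x : G => x \in A).

Definition setmul A B : set G := [set a * b | a in A & b in B].

Definition lcoset g A : set G := [set g * a | a in A].

Definition lcosets A : set (set G) := [set lcoset g A | g in [set: G]].

Definition finite_index A := finite_set (lcosets A).

Lemma subgroup1 A : subgroup A -> A 1.
Proof. by case=> /set_mem. Qed.

Lemma subgroupM A x y : subgroup A -> A x -> A y -> A (x * y).
Proof.
by move=> /group_closedM sA Ax Ay; apply/set_mem/sA; exact/mem_set.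
Qed.

Lemma lcoset1 A : lcoset 1 A = A.
Proof.
by rewrite /lcoset -[RHS]image_id; apply: eq_imagel => a _; rewrite mul1g.
Qed.

Lemma lcosetM g h A : lcoset (g * h) A = lcoset g (lcoset h A).
Proof.
by rewrite /lcoset image_comp; apply: eq_imagel => a _ /=; rewrite mulgA.
Qed.

Lemma setmul_lcoset A B g : subgroup A -> subgroup B -> A `<=` B ->
  setmul (lcoset g A) B = lcoset g B.
Proof.
move=> sA sB AB; apply/seteqP; split=> [_ [_ [a Aa <-] [b Bb <-]]|_ [b Bb <-]].
  exists (a * b); last by rewrite mulgA.
  exact: (subgroupM sB (AB _ Aa) Bb).
exists g; last by exists b.
by exists 1; [exact: subgroup1|rewrite mulg1].
Qed.

Lemma lcoset_lcosets A g C : lcosets A C -> lcosets A (lcoset g C).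
Proof. by move=> [x _ <-]; exists (g * x) => //; rewrite lcosetM. Qed.

Lemma setmul_lcosets A B C : subgroup A -> subgroup B -> A `<=` B ->
  lcosets A C -> lcosets B (setmul C B).
Proof. by move=> sA sB AB [x _ <-]; exists x => //; rewrite setmul_lcoset. Qed.

Lemma setmul_lcosetl g A B : setmul (lcoset g A) B = lcoset g (setmul A B).
Proof.
apply/seteqP; split=> [_ [_ [a Aa <-] [b Bb <-]]|_ [_ [a Aa [b Bb <-]] <-]].
  by exists (a * b); [exists a => //; exists b|rewrite mulgA].
by exists (g * a); [exists a|exists b => //; rewrite mulgA].
Qed.

End Cosets.

Definition finitely_generated (G : groupType) :=
  exists S : set G, finite_set S /\ smallest subgroup S = [set: G].

Definition renormalization (G : groupType) (phi : {multiplicative G -> G}) :=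
  [/\ injective phi, range phi <> [set: G] & finite_index (range phi)].

(* Actions of a discrete group by continuous maps, hence by homeomorphisms. *)
Record topAction (H : groupType) (X : topologicalType) := TopAction {
  act :> H -> X -> X;
  act1 : forall x, act 1 x = x;
  actM : forall g h x, act (g * h) x = act g (act h x);
  act_continuous : forall g, continuous (act g) }.

Section ActionProperties.
Context {H : groupType} {X : topologicalType} (Phi : topAction H X).

Definition quasi_analytic := forall (U : set X) (g : H),
  clopen U -> U !=set0 -> Phi g @` U = U -> (forall x, U x -> Phi g x = x) ->
  forall x, Phi g x = x.

Definition effective := forall g : H, (forall x, Phi g x = x) -> g = 1.

Definition nowhere_dense (A : set X) := interior (closure A) = set0.

Definition meager (A : set X) := exists F : nat -> set X,
  (forall n, nowhere_dense (F n)) /\ A `<=` \bigcup_n F n.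

Definition topologically_free :=
  meager [set x | exists g : H, g <> 1 /\ Phi g x = x].

End ActionProperties.

Section Tower.
Context {G : groupType} (phi : {multiplicative G -> G}).

Definition Gamma (l : nat) : set G := range (iter l phi).

Lemma iter_multiplicative l : {morph iter l phi : x y / x * y}.
Proof. by elim: l => // l IH x y /=; rewrite IH gmulfM. Qed.

Lemma subgroup_Gamma l : subgroup (Gamma l).
Proof.
have fM := iter_multiplicative l.
have f1 : iter l phi 1 = 1.
  by apply: (@mulgI _ (iter l phi 1)); rewrite -fM !mulg1.
split; first by apply/mem_set; exists 1.
move=> u v /set_mem[x _ <-] /set_mem[y _ <-].
apply/mem_set; exists (x / y) => //.
by apply: (@mulIg _ (iter l phi y)); rewrite -fM !mulgVK.
Qed.

Lemma Gamma_subset l : Gamma l.+1 `<=` Gamma l.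
Proof. by move=> _ [x _ <-]; exists (phi x) => //; rewrite iterSr. Qed.

Definition level (l : nat) := discrete_topology (lcosets (Gamma l)).

(* C |-> C Gamma_l, so that g Gamma_(l+1) |-> g Gamma_l by level_mapE. *)
Definition level_map l (C : level l.+1) : level l :=
  SigSub (mem_set (setmul_lcosets (subgroup_Gamma l.+1) (subgroup_Gamma l)
    (@Gamma_subset l) (set_mem (valP C)))).

Lemma level_mapE l (C : level l.+1) g :
  val C = lcoset g (Gamma l.+1) -> val (level_map C) = lcoset g (Gamma l).
Proof.
move=> /= ->; apply: setmul_lcoset; [exact: subgroup_Gamma..|].
exact: Gamma_subset.
Qed.

Definition level_act l (g : G) (C : level l) : level l :=
  SigSub (mem_set (lcoset_lcosets g (set_mem (valP C)))).

Lemma level_map_act l g (C : level l.+1) :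
  level_map (level_act g C) = level_act g (level_map C).
Proof. by apply: val_inj; exact: setmul_lcosetl. Qed.

Definition inverse_limit : set (prod_topology level) :=
  [set x : prod_topology level | forall l, @level_map l (x l.+1) = x l].

Definition limit_space : topologicalType := inverse_limit.

Lemma prod_act_inverse_limit g (x : prod_topology level) : inverse_limit x ->
  inverse_limit (fun l => level_act g (x l)).
Proof. by move=> xX l; rewrite level_map_act xX. Qed.

Definition limit_act (g : G) (x : limit_space) : limit_space :=
  SigSub (mem_set (prod_act_inverse_limit g (set_mem (valP x)))).

Lemma limit_act1 x : limit_act 1 x = x.
Proof.
apply/val_inj/functional_extensionality_dep => l.
by apply: val_inj; exact: lcoset1.
Qed.

Lemma limit_actM g h x : limit_act (g * h) x = limit_act g (limit_act h x).
Proof.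
apply/val_inj/functional_extensionality_dep => l.
by apply: val_inj; exact: lcosetM.
Qed.

Lemma limit_act_continuous g : continuous (limit_act g).
Proof.
pose pr l (x : limit_space) : level l := (val x : prod_topology level) l.
have pr_cts l : continuous (pr l).
  move=> x; apply: (@continuous_comp limit_space (prod_topology level) (level l)
    set_val (@proj _ level l)).
    exact: initial_continuous.
  exact: proj_continuous.
have h_cts l : continuous (fun x => level_act g (pr l x)).
  move=> x; apply: (@continuous_comp _ _ _ (pr l) (level_act g)).
    exact: pr_cts.
  move=> U /nbhs_singleton Ux.
  by apply: filterS (discrete_set1 _) => _ ->.
apply: continuous_comp_initial => x.
have FF : Filter ((set_val \o limit_act g) y @[y --> x]).
  exact: (@fmap_filter _ _ _ _ (@nbhs_filter limit_space x)).
apply/(cvg_sup _ _ FF) => l; apply: continuous_comp_initial; exact: h_cts.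
Qed.

Definition limit_action : topAction G limit_space :=
  TopAction limit_act1 limit_actM limit_act_continuous.

End Tower.

(* Main.v *)
Require Import Defs.
From mathcomp Require Import all_boot.
From mathcomp Require Import all_classical topology.

(** Write Gamma_inf for the intersection of the Gamma_l and N for its normal
core, the largest normal subgroup of G contained in it; N acts trivially on
the inverse limit.  The crux is that phi maps N into N.

Suppose this known, and let g fix every point of a cylinder, that is, every
point that agrees with some a Gamma_l at level l.  Then g ^ a fixes the points
coming from Gamma_l.  In particular it lies in Gamma_inf, so it is
iter l phi w for some w.  As iter l phi carries the tower above level 0 onto
the tower above level l, and intertwines w with g ^ a, the element w fixes the
coset of every k in G at all levels, so w lies in N.  By invariance
g ^ a = iter l phi w lies in N, hence so does g, and g acts trivially
([fix_cylinder_normal_core]).  Cylinders form a base of the topology, so this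
is quasi-analyticity.

For the invariance, phi restricts to a bijection of Gamma_inf, and injectivity
gives the easy half: N is contained in phi(N), so every element of N has
preimages in N under all iterates of phi ([normal_core_iter_preim]).  The
reverse inclusion is where finite generation enters ([normal_core_phi]).  A
finitely generated group acts in only finitely many ways on the finite set
G / Gamma_l, so among the actions obtained by twisting left translation by the
iterates of phi two coincide, say for i < j ([equal_coset_actions]).  Given g
in N write g = iter j.-1 phi h with h in N.  Then phi g = iter j phi h acts on
G / Gamma_l as iter i phi h, which is the preimage of g in N under
iter (j.-1 - i) phi and so acts trivially.  Since l is arbitrary, phi g is
in N.

Topological freeness: the group is countable, so it is enough that the fixed
point set of each g other than 1 is nowhere dense.  This set is closed, so if
it is dense in some cylinder it contains that cylinder; then g acts trivially,
and g = 1 when the action is effective. *)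

(** * Finitely generated groups and finite index subgroups *)

Section Groups.
Set Implicit Arguments.
Unset Strict Implicit.
Unset Printing Implicit Defensive.
Import Algebra.
Local Open Scope classical_set_scope.
Local Open Scope group_scope.

Lemma subgroupV (G : groupType) (A : set G) x : subgroup A -> A x -> A x^-1.
Proof.
by move=> /group_closedV sA Ax; apply/set_mem/sA/mem_set.
Qed.

Lemma subgroup_intro (G : groupType) (A : set G) :
  A 1 -> (forall x y, A x -> A y -> A (x / y)) -> subgroup A.
Proof.
move=> A1 AF; split; first exact/mem_set.
by move=> x y /set_mem Ax /set_mem Ay; apply/mem_set/AF.
Qed.

Lemma eq_lcoset (G : groupType) (A : set G) x y : subgroup A ->
  lcoset x A = lcoset y A <-> A (x^-1 * y).
Proof.
move=> sA; split=> [xy|Axy].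
  have : lcoset x A y by rewrite xy; exists 1; [exact: subgroup1|rewrite mulg1].
  by case=> a Aa <-; rewrite mulKg.
apply/seteqP; split=> _ [a Aa <-].
  exists ((x^-1 * y)^-1 * a); last by rewrite invgM invgK !mulgA mulgV mul1g.
  exact/(subgroupM sA)/Aa/(subgroupV sA).
exists (x^-1 * y * a); first exact: subgroupM.
by rewrite !mulgA mulgV mul1g.
Qed.

Lemma generators_ind (G : groupType) (S H : set G) :
  smallest subgroup S = [set: G] -> subgroup H -> S `<=` H -> forall g, H g.
Proof.
move=> Sgen sH SH g.
by apply: (smallest_sub (C := subgroup)) SH _ _ => //; rewrite Sgen.
Qed.

Lemma finitely_generated_enum (G : groupType) : finitely_generated G ->
  exists e : nat -> G, forall g, exists n, e n = g.
Proof.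
case=> S [/finite_seqP[s ->] sgen].
(* A letter (n, b) is the n-th generator, inverted when b is false. *)
pose ev (w : seq (nat * bool)) : G :=
  foldr (fun p x => (if p.2 then nth 1 s p.1 else (nth 1 s p.1)^-1) * x) 1 w.
have ev_cat w w' : ev (w ++ w') = ev w * ev w'.
  by elim: w => [|p w IH] /=; rewrite ?mul1g // IH mulgA.
have evV w : exists w', ev w' = (ev w)^-1.
  elim: w => [|[n b] w [w' IH]]; first by exists [::]; rewrite /= invg1.
  exists (w' ++ [:: (n, ~~ b)]); rewrite ev_cat IH /= mulg1 invgM.
  by case: b; rewrite /= ?invgK.
exists (fun n => odflt 1 (omap ev (unpickle n))).
suff H g : exists w, ev w = g.
  by move=> g; have [w <-] := H g; exists (pickle w); rewrite pickleK.
apply: (generators_ind (H := [set g | exists w, ev w = g]) sgen).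
  apply: subgroup_intro; first by exists [::].
  move=> _ _ [u <-] [v <-]; have [v' v'E] := evV v.
  by exists (u ++ v'); rewrite ev_cat v'E.
move=> x /= xs; exists [:: (index x s, true)].
by rewrite /= mulg1 nth_index.
Qed.

Lemma morph1 (G : groupType) (f : G -> G) : {morph f : x y / x * y} -> f 1 = 1.
Proof. by move=> fM; apply: (@mulgI _ (f 1)); rewrite -fM !mulg1. Qed.

Lemma morphV (G : groupType) (f : G -> G) :
  {morph f : x y / x * y} -> {morph f : x / x^-1}.
Proof.
by move=> fM x; apply: (@mulgI _ (f x)); rewrite -fM !mulgV morph1.
Qed.

(** An action of a finitely generated group on a finite set is determined by the
images of the generators, so an infinite sequence of actions on G / A through
endomorphisms f i has a repetition. *)
Lemma equal_coset_actions (G : groupType) (A : set G) (f : nat -> G -> G) :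
  finitely_generated G -> finite_index A ->
  (forall i, {morph f i : x y / x * y}) ->
  exists i j, (i < j)%N /\
    forall g C, lcosets A C -> lcoset (f i g) C = lcoset (f j g) C.
Proof.
case=> S [/finite_seqP[s ->] sgen] /finite_seqP[cs csE] fM.
(* The table of the i-th action.  The extra element of the target is the value
   that index takes off the list; it makes the target inhabited. *)
pose code i : {ffun 'I_(size s) * 'I_(size cs) -> 'I_(size cs).+1} :=
  [ffun p : 'I_(size s) * 'I_(size cs) =>
    inord (index (lcoset (f i (nth 1 s p.1)) (nth set0 cs p.2)) cs)].
have [i [j [ij codeE]]] : exists i j, (i < j)%N /\ code i = code j.
  pose n := #|{ffun 'I_(size s) * 'I_(size cs) -> 'I_(size cs).+1}|.
  have /injectivePn[i [j ij cij]] : ~~ injectiveb (fun i : 'I_n.+1 => code i).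
    by apply/negP => /injectiveP/leq_card; rewrite card_ord ltnn.
  have := ij; rewrite -val_eqE /= neq_ltn => /orP[?|?]; first by exists i, j.
  by exists j, i.
exists i, j; split => //.
apply: (generators_ind sgen).
  apply: subgroup_intro => [C _|x y fx fy C AC]; first by rewrite !morph1.
  have fyV : lcoset (f i y^-1) C = lcoset (f j y^-1) C.
    have AD : lcosets A (lcoset (f i y)^-1 C) by exact: lcoset_lcosets.
    have := fy _ AD; rewrite -lcosetM mulgV lcoset1 => CE.
    by rewrite !morphV // [in RHS]CE -lcosetM mulVg lcoset1.
  rewrite !fM !lcosetM fyV fx //.
  exact: lcoset_lcosets.
move=> g /= gs C AC.
have inC D : lcosets A D -> D \in cs by rewrite csE.
have gs' : (index g s < size s)%N by rewrite index_mem.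
have Ccs' : (index C cs < size cs)%N by rewrite index_mem inC.
have /ffunP/(_ (Ordinal gs', Ordinal Ccs'))/(congr1 val) := codeE.
rewrite !ffunE /= !nth_index //; last exact: inC.
rewrite !inordK ?ltnS ?index_size // => /(congr1 (nth set0 cs)).
by rewrite !nth_index //; apply/inC/lcoset_lcosets.
Qed.

(** Representatives make finite index transitive along the tower: they can be
multiplied, whereas cosets of different subgroups cannot. *)
Lemma finite_index_reps (G : groupType) (A : set G) : subgroup A ->
  finite_index A <->
  exists R : set G, finite_set R /\ forall g, exists2 r, R r & A (r^-1 * g).
Proof.
move=> sA; split=> [fA|[R [fR RA]]].
  have rep C : exists r, lcosets A C -> lcoset r A = C.
    by have [[r _ rC]|nC] := pselect (lcosets A C); [exists r|exists 1].
  have [r rE] := choice rep.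
  exists (r @` lcosets A); split; first exact: finite_image.
  move=> g; have gA : lcosets A (lcoset g A) by exists g.
  exists (r (lcoset g A)); first by exists (lcoset g A).
  by apply/eq_lcoset => //; exact: rE.
apply: sub_finite_set (finite_image (fun r => lcoset r A) fR).
move=> _ [g _ <-]; have [r Rr rg] := RA g.
by exists r => //; apply/eq_lcoset.
Qed.

End Groups.

(** * The intersection of the tower and its normal core *)

Section Renormalization.
Set Implicit Arguments.
Unset Strict Implicit.
Unset Printing Implicit Defensive.
Import Algebra.
Local Open Scope classical_set_scope.
Local Open Scope group_scope.
Context {G : groupType} (phi : {multiplicative G -> G}).

Lemma iter_phi1 l : iter l phi 1 = 1.
Proof. exact: morph1 (iter_multiplicative phi l). Qed.

Lemma iter_phiJ l : {morph iter l phi : x y / x ^ y}.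
Proof.
move=> x y; rewrite !conjgE !iter_multiplicative morphV //.
exact: iter_multiplicative.
Qed.

Lemma finite_index_Gamma l : finite_index (range phi) ->
  finite_index (Gamma phi l).
Proof.
move=> fphi.
have /finite_index_reps[] := fphi; first exact: (subgroup_Gamma phi 1).
move=> R1 [fR1 R1P].
suff [R [fR RP]] : exists R : set G, finite_set R /\
    forall g, exists2 r, R r & Gamma phi l (r^-1 * g).
  by apply/finite_index_reps; [exact: subgroup_Gamma|exists R].
elim: l => [|l [R [fR RP]]].
  exists [set 1]; split; first exact: finite_set1.
  by move=> g; exists 1 => //; exists (1^-1 * g).
exists [set x * phi y | x in R1 & y in R]; split; first exact: finite_image2.
move=> g; have [x R1x [h _ hE]] := R1P g; have [y Ry [k _ kE]] := RP h.
exists (x * phi y); first by exists x => //; exists y.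
by exists k => //=; rewrite kE gmulfM (morphV (@gmulfM _ _ phi)) hE invgM -mulgA.
Qed.

Lemma iter_phi_inj l : injective phi -> injective (iter l phi).
Proof. by move=> inj; elim: l => // l IH x y /= /inj/IH. Qed.

Definition Gamma_inf : set G := \bigcap_l Gamma phi l.
Definition normal_core : set G := [set g | forall x, Gamma_inf (g ^ x)].

(** By injectivity, membership of iter l phi g in Gamma_(l+m) is the same as
membership of g in Gamma_m. *)
Lemma Gamma_inf_iter (inj : injective phi) l g :
  Gamma_inf (iter l phi g) <-> Gamma_inf g.
Proof.
split=> rg m _.
  have [x _ /esym] := rg (l + m)%N I.
  by rewrite iterD => /(iter_phi_inj inj) ->; exists x.
have [ml|lm] := leqP m l.
  exists (iter (l - m) phi g) => //; by rewrite -iterD subnKC.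
have [x _ <-] := rg (m - l)%N I.
by exists x => //; rewrite -iterD subnKC // ltnW.
Qed.

(** A preimage h of g lies in the core because the conjugates of h are sent to
conjugates of g, and phi reflects membership in Gamma_inf. *)
Lemma normal_core_iter_preim (inj : injective phi) l g : normal_core g ->
  exists2 h, normal_core h & g = iter l phi h.
Proof.
move=> cg; have := cg 1; rewrite conjg1 => /(_ l I)[h _ hE].
exists h => // x; apply/(Gamma_inf_iter inj l).
by rewrite iter_phiJ hE; exact: cg.
Qed.

(** Left translation by phi g on G / Gamma_l equals that by an earlier element
of the backward phi-orbit of g, which lies in the core. *)
Lemma normal_core_phi (inj : injective phi) (fin : finite_index (range phi))
  (fg : finitely_generated G) g : normal_core g -> normal_core (phi g).
Proof.
move=> cg x l _.
have [i [j [ij ijE]]] := equal_coset_actions fg (finite_index_Gamma l fin)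
  (iter_multiplicative phi).
case: j ij ijE => // j; rewrite ltnS => ij ijE.
have [h ch gE] := normal_core_iter_preim inj j cg.
have ch' : normal_core (iter i phi h).
  have [h' ch' gE'] := normal_core_iter_preim inj (j - i) cg.
  suff -> : iter i phi h = h' by [].
  by apply: (iter_phi_inj (l := j - i) inj); rewrite -iterD subnK // -gE.
have := ijE h (lcoset x (Gamma phi l)); rewrite -!lcosetM /= -gE => E.
have {E} xE : lcoset (iter i phi h * x) (Gamma phi l) =
    lcoset (phi g * x) (Gamma phi l).
  by apply: E; exists x.
have h'x : lcoset x (Gamma phi l) = lcoset (iter i phi h * x) (Gamma phi l).
  by apply/eq_lcoset; [exact: subgroup_Gamma|exact: ch'].
by rewrite conjgE; apply/eq_lcoset; [exact: subgroup_Gamma|rewrite h'x].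
Qed.

Lemma normal_coreJ g x : normal_core g -> normal_core (g ^ x).
Proof. by move=> cg y; rewrite -conjgM; exact: cg. Qed.

(** * Cylinders of the inverse limit *)

Definition coord l (x : limit_space phi) : level phi l :=
  (val x : prod_topology (level phi)) l.

Definition cylinder (x : limit_space phi) l : set (limit_space phi) :=
  [set y | coord l y = coord l x].

Lemma eq_limit_space (x y : limit_space phi) :
  (forall l, coord l x = coord l y) -> x = y.
Proof. by move=> xy; apply/val_inj/functional_extensionality_dep. Qed.

Lemma coord_act l g x : coord l (limit_act g x) = level_act g (coord l x).
Proof. by []. Qed.

Lemma eq_coord_le l m x y : (l <= m)%N -> coord m x = coord m y ->
  coord l x = coord l y.
Proof.
move=> /subnKC <-; elim: (m - l)%N => [|k IH]; rewrite ?addn0 // addnS => xy.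
apply: IH; have xP := set_mem (valP x); have yP := set_mem (valP y).
by rewrite /coord -(xP (l + k)%N) -(yP (l + k)%N); congr level_map.
Qed.

Lemma val_coord l x : exists a, val (coord l x) = lcoset a (Gamma phi l).
Proof. by have [a _ <-] := set_mem (valP (coord l x)); exists a. Qed.

Definition orbit_coord (a : G) l : level phi l :=
  SigSub (mem_set (ex_intro2 [set: G] _ a I (erefl (lcoset a (Gamma phi l))))).

Lemma orbit_inverse_limit a : inverse_limit (orbit_coord a).
Proof. by move=> l; apply: val_inj; exact: level_mapE. Qed.

Definition orbit_point a : limit_space phi :=
  SigSub (mem_set (orbit_inverse_limit a)).

Lemma coord_continuous l : continuous (coord l).
Proof.
move=> x; apply: (@continuous_comp (limit_space phi) (prod_topology (level phi))
  (level phi l) set_val (@proj _ (level phi) l)).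
  exact: initial_continuous.
exact: proj_continuous.
Qed.

Lemma nbhs_cylinder x l : nbhs x (cylinder x l).
Proof.
have -> : cylinder x l = coord l @^-1` [set coord l x] by [].
apply: open_nbhs_nbhs; split=> //.
move/continuousP: (@coord_continuous l); apply; exact: discrete_open.
Qed.

(** The coordinates determine each other downwards, so the cylinders around x
are nested and generate a filter; it converges to x in each coordinate, hence
in the product and in the subspace. *)
Lemma nbhs_sub_cylinder x B : nbhs x B -> exists l, cylinder x l `<=` B.
Proof.
pose F := filter_from [set: nat] (cylinder x).
have FF : Filter F.
  apply: filter_from_filter; first by exists 0%N.
  move=> i j _ _; exists (maxn i j) => // y xy.
  by split; apply: (eq_coord_le _ xy); rewrite ?leq_maxl ?leq_maxr.
have Fcvg : (val @ F) --> (val x : prod_topology (level phi)).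
  apply/(cvg_sup _ _ (fmap_filter _ _)) => l.
  move=> U [?/= [[W oW <-]]] /= Wx /filterS; apply.
  by exists l => // y /= xy; rewrite /= -/(coord l y) xy.
move=> [?/= [[W oW <-]]] /= Wx BW.
have [l _ lW] : F (val @^-1` W) by apply: Fcvg; exact: open_nbhs_nbhs.
by exists l; apply: subset_trans BW.
Qed.

Lemma normal_core_act g : normal_core g ->
  forall x : limit_space phi, limit_act g x = x.
Proof.
move=> cg x; apply: eq_limit_space => l; apply: val_inj.
rewrite coord_act /=; have [a ->] := val_coord l x; rewrite -lcosetM.
apply/esym/eq_lcoset; first exact: subgroup_Gamma.
exact: cg.
Qed.

(** * Fixed points and the theorem *)

(** If a represents the l-th coordinate of x, every orbit point of
a * iter l phi k lies in the cylinder.  That g fixes these points pulls back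
under iter l phi to membership of a preimage of g ^ a in the core. *)
Lemma fix_cylinder_normal_core (inj : injective phi)
    (fin : finite_index (range phi)) (fg : finitely_generated G) g x l :
  (forall y, cylinder x l y -> limit_act g y = y) -> normal_core g.
Proof.
move=> gfix; have [a xa] := val_coord l x.
have fixG k : Gamma_inf (g ^ (a * iter l phi k)).
  move=> m _; have bx : cylinder x l (orbit_point (a * iter l phi k)).
    apply: val_inj; rewrite xa /=; apply/esym/eq_lcoset.
      exact: subgroup_Gamma.
    by exists k => //; rewrite mulKg.
  have /(congr1 (fun y => val (coord m y))) := gfix _ bx.
  by rewrite /= -lcosetM => /esym/(eq_lcoset _ _ (subgroup_Gamma phi m)).
have ga : Gamma_inf (g ^ a) by have := fixG 1; rewrite iter_phi1 mulg1.
have [w _ wE] := ga l I.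
have cw : normal_core w.
  move=> k; apply/(Gamma_inf_iter inj l).
  by rewrite iter_phiJ wE -conjgM; exact: fixG.
have -> : g = (iter l phi w) ^ a^-1 by rewrite wE conjgK.
apply: normal_coreJ; elim: (X in iter X) => // m IH.
by apply: normal_core_phi.
Qed.

(** At each level m the cylinder of y at m meets the fixed point set, and fixing
the m-th coordinate depends on that coordinate only. *)
Lemma fix_dense_in_cylinder g x l :
  cylinder x l `<=` closure [set y | limit_act g y = y] ->
  forall y, cylinder x l y -> limit_act g y = y.
Proof.
move=> Fcl y /Fcl yF; apply: eq_limit_space => m.
have [z [/= gz zy]] := yF _ (nbhs_cylinder y m).
by rewrite coord_act -zy -coord_act gz.
Qed.

End Renormalization.

Theorem theorem1p2 (G : groupType) (phi : {multiplicative G -> G})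
    (fgG : finitely_generated G) (phi_renorm : renormalization phi) :
  quasi_analytic (limit_action phi) /\
  (effective (limit_action phi) -> topologically_free (limit_action phi)).
Proof.
have [inj _ fin] := phi_renorm.
have core g x l :
    (forall y : limit_space phi, cylinder x l y -> limit_act g y = y) ->
    forall y : limit_space phi, limit_act g y = y.
  move=> gfix; apply: normal_core_act.
  exact: (fix_cylinder_normal_core inj fin fgG gfix).
split=> [U g [Uop _] [x Ux] _ gU|eff].
  have [l lU] := nbhs_sub_cylinder (open_nbhs_nbhs (conj Uop Ux)).
  by apply: (core g x l) => y /lU/gU.
have [e eP] := finitely_generated_enum fgG.
(* The condition e n <> 1 empties the fixed point set of the identity, which is
   the whole space. *)
exists (fun n =>
  [set x : limit_space phi | e n <> 1%g /\ limit_act (e n) x = x]%classic).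
split; last first.
  by move=> x [g [g1 gx]]; have [n ng] := eP g; exists n => //=; rewrite ng.
move=> n; apply/seteqP; split=> // x /nbhs_sub_cylinder[l lF].
have [en1|en1] := pselect (e n = 1%g).
  by have [y [[]]] := lF x erefl _ (nbhs_cylinder x l).
apply: en1; apply: eff => y; apply: (core (e n) x l); apply: fix_dense_in_cylinder.
by apply: subset_trans lF _; apply: closureS => z [].
Qed.
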